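(* Let $\mathbf{e}$ be a transitive relation on a set $E$. The completely join-irreducible elements of the lattice $\mathrm{Reg}(\mathbf{e})$ are exactly the sets $\mathbf{p}_{a,b,U}$ with $(a,b,U)\in\mathcal{F}(\mathbf{e})$. Furthermore, $\mathrm{Reg}(\mathbf{e})$ is spatial, i.e., every element is a (possibly infinite) join of completely join-irreducible elements.
   Context: A transitive relation $\mathbf{e}$ on $E$ is viewed as a set of ordered pairs. Write $x\lhd y$ if $(x,y)\in\mathbf{e}$, $x\unlhd y$ if ($x\lhd y$ or $x=y$), and $[a,b]=\{x: a\unlhd x\unlhd b\}$. A subset $\mathbf{a}\subseteq\mathbf{e}$ is closed if transitive, open if $\mathbf{e}\setminus\mathbf{a}$ is transitive; $\mathrm{cl}$ is transitive closure, $\mathrm{int}(\mathbf{a})$ the largest open subset of $\mathbf{a}$; $\mathbf{a}$ is regular closed if $\mathbf{a}=\mathrm{cl}(\mathrm{int}(\mathbf{a}))$. $\mathrm{Reg}(\mathbf{e})$ is the complete lattice of regular closed subsets under inclusion (joins $\mathrm{cl}(\bigcup)$, meets $\mathrm{cl}(\mathrm{int}(\bigcap))$). $\mathcal{F}(\mathbf{e})$ is the set of triples $(a,b,U)$ with $(a,b)\in\mathbf{e}$, $U\subseteq[a,b]$, and such that $a\neq b$ implies $a\notin U$ and $b\in U$; put $U^{\mathsf c}=[a,b]\setminus U$ and $\mathbf{p}_{a,b,U}=\mathbf{e}\cap\big((\{a\}\cup U^{\mathsf c})\times(\{b\}\cup U)\big)$. An element $p$ is completely join-irreducible if it has a unique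 lower cover $p_*$ and every $x<p$ satisfies $x\le p_*$. *)

(* Defs.v *)
From Stdlib Require Import Relation_Operators.
From HB Require Import structures.
From mathcomp Require Import all_boot all_order.
From mathcomp Require Import boolp classical_sets.

Set Implicit Arguments.
Unset Strict Implicit.
Unset Printing Implicit Defensive.

Local Open Scope classical_set_scope.

Section Relations.
Variable E : Type.
Implicit Types a e : set (E * E).

Definition rel_transitive a := forall x y z, a (x, y) -> a (y, z) -> a (x, z).

Definition rel_cl a : set (E * E) :=
  [set xy | clos_trans E (fun x y => a (x, y)) xy.1 xy.2].

Definition rel_open e a := a `<=` e /\ rel_transitive (e `\` a).

(* A union of open sets is open, so this is the largest open subset of a
   (see rel_int_open). *)
Definition rel_int e a : set (E * E) :=
  \bigcup_(u in [set u | rel_open e u /\ u `<=` a]) u.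

Definition regular_closed e : set (set (E * E)) :=
  [set a | a `<=` e /\ a = rel_cl (rel_int e a)].

Definition rel_le e x y := e (x, y) \/ x = y.

Definition rel_interval e x y := [set z | rel_le e x z /\ rel_le e z y].

Definition triples e : set (E * E * set E) :=
  [set t | let: (a, b, U) := t in
    [/\ e (a, b), U `<=` rel_interval e a b & a <> b -> ~ U a /\ U b]].

Definition p_rel e (t : E * E * set E) : set (E * E) :=
  let: (a, b, U) := t in
  e `&` ((a |` (rel_interval e a b `\` U)) `*` (b |` U)).

End Relations.

(* [set_type] turns the set of regular closed subsets into a subtype of
   [set (E * E)]; its order is the one induced by inclusion. *)
Definition Reg (E : Type) (e : set (E * E)) : Type :=
  set_type (regular_closed e).

Section RegOrder.
Variables (E : Type) (e : set (E * E)).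
HB.instance Definition _ := SubChoice.on (Reg e).
HB.instance Definition _ :=
  [SubChoice_isSubPOrder of Reg e by <: with set_display].
End RegOrder.

Section Posets.
Context {d : Order.disp_t} {T : porderType d}.
Implicit Types p q x : T.
Local Open Scope order_scope.

Definition lower_cover p q := q < p /\ forall x, ~ (q < x /\ x < p).

Definition completely_join_irreducible p :=
  exists ps, unique (lower_cover p) ps /\ forall x, x < p -> x <= ps.

End Posets.

(* [supremums S] is the set of least upper bounds of S (at most one). *)
Definition spatial (d : Order.disp_t) (T : porderType d) :=
  forall x : T, exists2 S : set T,
    S `<=` [set p | completely_join_irreducible p] & supremums S x.

(* [Reg e] is a complete lattice: supremums_RegP and infimums_RegP compute the
   joins and meets of its inclusion order. *)
Section RegLattice.
Variables (E : Type) (e : set (E * E)).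
Implicit Types a b : set (E * E).

Lemma rel_cl_trans a : rel_transitive (rel_cl a).
Proof. by move=> x y z; apply: t_trans. Qed.

Lemma sub_rel_cl a : a `<=` rel_cl a.
Proof. by move=> [x y] axy; apply: t_step. Qed.

Lemma rel_cl_min a b : rel_transitive b -> a `<=` b -> rel_cl a `<=` b.
Proof.
move=> btr ab [x y]; rewrite /rel_cl /= => h.
by elim: h => {x y} [x y /ab//|x y z _ bxy _ byz]; apply: btr bxy byz.
Qed.

Lemma rel_cl_mono a b : a `<=` b -> rel_cl a `<=` rel_cl b.
Proof.
by move=> ab; apply: rel_cl_min => [|x /ab]; [apply: rel_cl_trans|apply: sub_rel_cl].
Qed.

Lemma rel_int_sub a : rel_int e a `<=` a.
Proof. by move=> x [u [_ ua] ux]; apply: ua. Qed.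

Lemma rel_int_max a u : rel_open e u -> u `<=` a -> u `<=` rel_int e a.
Proof. by move=> uo ua x ux; exists u. Qed.

Hypothesis etr : rel_transitive e.

Lemma rel_int_open a : rel_open e (rel_int e a).
Proof.
split=> [x [u [[ue _] _] ux]|x y z]; first exact: ue.
move=> [exy nxy] [eyz nyz]; split; first exact: etr exy eyz.
move=> [u [uo ua] uxz].
have [_ ut] := uo.
have uN w : ~ rel_int e a w -> ~ u w by move=> n uw; apply: n; exists u.
by have [] := ut x y z (conj exy (uN _ nxy)) (conj eyz (uN _ nyz)).
Qed.

Lemma rel_int_mono a b : a `<=` b -> rel_int e a `<=` rel_int e b.
Proof.
move=> ab; apply: rel_int_max; first exact: rel_int_open.
by move=> x /rel_int_sub/ab.
Qed.

Lemma regular_cl_int a : regular_closed e (rel_cl (rel_int e a)).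
Proof.
have [ie _] := rel_int_open a.
have ce : rel_cl (rel_int e a) `<=` e by apply: rel_cl_min.
split=> //; apply/seteqP; split; apply: rel_cl_min; try exact: rel_cl_trans.
  move=> x ix; apply: sub_rel_cl; move: x ix; apply: rel_int_max.
    exact: rel_int_open.
  exact: sub_rel_cl.
exact: rel_int_sub.
Qed.

Lemma regP (r : Reg e) : regular_closed e (val r).
Proof. by have := valP r; rewrite inE. Qed.

Lemma leRegP (r s : Reg e) : (r <= s)%O <-> val r `<=` val s.
Proof. by rewrite -Order.le_val subsetEset. Qed.

Lemma supremums_RegP (S : set (Reg e)) (x : Reg e) :
  supremums S x <-> val x = rel_cl (\bigcup_(r in S) val r).
Proof.
set u := \bigcup_(r in S) val r.
have key : rel_cl u = rel_cl (rel_int e (rel_cl u)).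
  apply/seteqP; split; apply: rel_cl_min; try exact: rel_cl_trans.
    move=> z [r Sr rz]; have [_ rE] := regP r; move: rz; rewrite rE.
    apply: rel_cl_mono; apply: rel_int_mono => w rw; apply: sub_rel_cl.
    by exists r.
  exact: rel_int_sub.
have ureg : rel_cl u \in regular_closed e.
  by rewrite inE key; apply: regular_cl_int.
split=> [[ub lb]|xE].
  apply/seteqP; split.
    have /lb /leRegP : ubound S (Sub (rel_cl u) ureg : Reg e).
      by move=> r Sr; apply/leRegP => z rz; apply: sub_rel_cl; exists r.
    by [].
  apply: rel_cl_min; last by move=> z [r /ub/leRegP rx /rx].
  by have [_ ->] := regP x; apply: rel_cl_trans.
split=> [r Sr|y uby]; apply/leRegP; rewrite xE.
  by move=> z rz; apply: sub_rel_cl; exists r.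
apply: rel_cl_min; last by move=> z [r /uby/leRegP ry /ry].
by have [_ ->] := regP y; apply: rel_cl_trans.
Qed.

(* The [e `&` _] only matters for the empty family, whose meet is e. *)
Lemma infimums_RegP (S : set (Reg e)) (x : Reg e) :
  infimums S x <->
  val x = rel_cl (rel_int e (e `&` \bigcap_(r in S) val r)).
Proof.
set m := e `&` _.
have mr r : S r -> rel_cl (rel_int e m) `<=` val r.
  move=> Sr; apply: rel_cl_min; last by move=> z /rel_int_sub[_]; apply.
  by have [_ ->] := regP r; apply: rel_cl_trans.
have mmax (y : Reg e) : lbound S y -> val y `<=` rel_cl (rel_int e m).
  move=> lby; have [ye yE] := regP y; rewrite {1}yE.
  apply/rel_cl_mono/rel_int_mono => z yz; split; first exact: ye.
  by move=> r /lby/leRegP; apply.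
have mreg : rel_cl (rel_int e m) \in regular_closed e.
  by rewrite inE; apply: regular_cl_int.
split=> [[lb ub]|xE].
  apply/seteqP; split; first exact: mmax.
  have /ub /leRegP : lbound S (Sub (rel_cl (rel_int e m)) mreg : Reg e).
    by move=> r Sr; apply/leRegP; apply: mr.
  by [].
by split=> [r Sr|y lby]; apply/leRegP; rewrite xE; [apply: mr|apply: mmax].
Qed.

End RegLattice.

(* Main.v *)
Require Import Defs.
From mathcomp Require Import all_boot all_order.
From mathcomp Require Import boolp classical_sets.

Local Open Scope classical_set_scope.

(** Each [p = p_{a,b,U}] is clopen, and deleting the pair [(a,b)] from [p] leaves
a transitive relation, because two pairs of [p] compose only through a point
[y = a = b].  Conversely an open subset of [p] that contains [(a,b)] is all of
[p].  Hence the regular closed sets properly below [p] are those that avoid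
[(a,b)], and they have a largest element, [cl (int (p \ {(a,b)}))].

If [u] is open and [(a,b)] lies in [u], then [U = {y in [a,b] | (a,y) in u}]
(with [a] removed when [a <> b]) gives [(a,b) in p_{a,b,U}] and [p_{a,b,U}]
contained in [u].  Applied to [u = int x], this writes every regular closed [x]
as a join of sets [p_{a,b,U}]; a completely join-irreducible [x] must then be
one of them. *)

Section PRel.
Set Implicit Arguments.
Unset Strict Implicit.
Variables (E : Type) (e : set (E * E)).
Hypothesis etr : rel_transitive e.

Lemma rel_le_trans x y z : rel_le e x y -> rel_le e y z -> rel_le e x z.
Proof.
move=> [xy|->//] [yz|<-]; last by left.
by left; apply: etr xy yz.
Qed.

Lemma p_rel_sub t : p_rel e t `<=` e.
Proof. by case: t => [[a b] U] x []. Qed.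

Lemma p_rel_endpoints a b U : e (a, b) -> p_rel e (a, b, U) (a, b).
Proof. by move=> ab; do !split=> //=; left. Qed.

Lemma p_rel_trans t : rel_transitive (p_rel e t).
Proof.
case: t => [[a b] U] x y z [xy [xl _]] [yz [_ zr]].
by split; first exact: etr xy yz.
Qed.

(** If [(x, z)] in [p] factors through [y], then [y] lies in [[a,b]]. It is a legal target when
    [U y] and a legal source otherwise, so one factor is in [p]. *)
Lemma p_rel_open t : triples e t -> rel_open e (p_rel e t).
Proof.
case: t => [[a b] U] [ab UI _]; split; first exact: p_rel_sub.
move=> x y z [exy nxy] [eyz nyz]; split; first exact: etr exy eyz.
move=> [_ [/= xl zr]].
have ax : rel_le e a x by case: xl => [->|[[]]//]; right.
have zb : rel_le e z b by case: zr => [->|/UI[]//]; right.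
have yI : rel_interval e a b y.
  by split; [apply: rel_le_trans ax _; left|apply: rel_le_trans zb; left].
have [yU|nyU] := pselect (U y).
  by apply: nxy; split=> //; split=> //=; right.
by apply: nyz; split=> //; split=> //=; right.
Qed.

Lemma p_rel_regular t : triples e t -> regular_closed e (p_rel e t).
Proof.
move=> Tt; split; first exact: p_rel_sub.
apply/seteqP; split.
  move=> x px; apply: sub_rel_cl; move: x px.
  by apply: rel_int_max => //; apply: p_rel_open.
by apply: rel_cl_min; [apply: p_rel_trans|apply: rel_int_sub].
Qed.

Lemma p_rel_mid a b U x y z : triples e (a, b, U) ->
  p_rel e (a, b, U) (x, y) -> p_rel e (a, b, U) (y, z) -> y = a /\ y = b.
Proof.
move=> [_ _ Uab] [_ [_ /= yr]] [_ [/= yl _]].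
have [ab|/Uab[nUa Ub]] := pselect (a = b).
  by rewrite -ab in yr *; case: yr yl => [|Uy] // [|[_]].
by case: yr yl => [->|Uy] [ya|[_ nUy]] //; move: nUa; rewrite -ya.
Qed.

Lemma p_rel_remove_trans a b U : triples e (a, b, U) ->
  rel_transitive (p_rel e (a, b, U) `\ (a, b)).
Proof.
move=> T x y z [pxy nxy] [pyz nyz]; split; first exact: p_rel_trans pxy pyz.
have [ya yb] := p_rel_mid T pxy pyz.
by move=> [xa zb]; apply: nxy; rewrite xa yb.
Qed.

Lemma open_in_p_rel a b U u : triples e (a, b, U) -> rel_open e u ->
  u `<=` p_rel e (a, b, U) -> u (a, b) -> u = p_rel e (a, b, U).
Proof.
move=> T [ue uo] up uab; apply/seteqP; split=> //.
have [eab UI Uab] := T.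
have split_u x y z : e (x, y) -> e (y, z) -> u (x, z) -> u (x, y) \/ u (y, z).
  move=> exy eyz uxz; apply: contrapT => /not_orP[nxy nyz].
  by have [] := uo x y z (conj exy nxy) (conj eyz nyz).
(* First the pairs starting at [a]: split [(a, b)] at [y]. The half [(y, b)] cannot be in [u], as it
   would compose with [(a, y)] inside [p]. *)
have row y : (b |` U) y -> u (a, y).
  move=> yr; have [->//|ny] := pselect (y = b).
  case: yr => [//|Uy].
  have [ay yb] := UI _ Uy.
  have eyb : e (y, b) by case: yb.
  have eay : e (a, y).
    case: ay => // ay; have [ab|/Uab[]] := pselect (a = b).
      by case: ny; rewrite -ay.
    by rewrite ay.
  case: (split_u _ _ _ eay eyb uab) => // uyb.
  have pay : p_rel e (a, b, U) (a, y).
    by split=> //; split=> /=; [left|right].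
  by have [] := p_rel_mid T pay (up _ uyb).
move=> [x y] pxy; have [exy [/= xl yr]] := pxy.
case: xl => [->|[[ax _] _]]; first exact: row.
case: ax => [ax|<-]; last exact: row.
(* Now split [(a, y)] at [x]; the half [(a, x)] composes with [(x, y)] inside [p], which forces
   [x = a]. *)
case: (split_u _ _ _ ax exy (row _ yr)) => // uax.
have [xa _] := p_rel_mid T (up _ uax) pxy.
by rewrite xa; apply: row.
Qed.

Lemma p_rel_below a b U (x : set (E * E)) : triples e (a, b, U) ->
  regular_closed e x -> x `<=` p_rel e (a, b, U) -> x (a, b) ->
  x = p_rel e (a, b, U).
Proof.
move=> T [xe xE] xp xab; apply/seteqP; split=> //.
(* Transitive closure cannot create [(a, b)], since [p] without this pair is already transitive. *)
have iab : rel_int e x (a, b).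
  apply: contrapT => nab.
  have : rel_cl (rel_int e x) `<=` p_rel e (a, b, U) `\ (a, b).
    apply: rel_cl_min; first exact: p_rel_remove_trans.
    move=> z iz; split; first exact: (xp _ (rel_int_sub iz)).
    by move=> zab; apply: nab; rewrite -zab.
  by rewrite -xE => /(_ _ xab) [_]; apply.
rewrite -(open_in_p_rel T (rel_int_open etr x) _ iab); first exact: rel_int_sub.
by move=> z /rel_int_sub/xp.
Qed.

Lemma p_rel_irreducible t (p : Reg e) : triples e t -> val p = p_rel e t ->
  completely_join_irreducible p.
Proof.
case: t => [[a b] U] T pE.
have [eab _ _] := T.
set m := p_rel e (a, b, U) `\ (a, b).
have mreg : rel_cl (rel_int e m) \in regular_closed e.
  by rewrite inE; apply: regular_cl_int.
pose ps : Reg e := Sub (rel_cl (rel_int e m)) mreg.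
have psm : val ps `<=` m.
  by apply: rel_cl_min; [apply: p_rel_remove_trans|apply: rel_int_sub].
have below x : (x < p)%O -> (x <= ps)%O.
  rewrite Order.POrderTheory.lt_neqAle => /andP[/eqP xp /leRegP].
  have [_ xE] := regP x; rewrite pE => lexp.
  apply/leRegP; rewrite xE; apply: rel_cl_mono; apply: rel_int_mono => // z xz.
  split; first exact: lexp.
  move=> zab; apply: xp; apply: val_inj; rewrite pE.
  by apply: p_rel_below => //; [apply: regP|rewrite -zab].
have psp : (ps < p)%O.
  rewrite Order.POrderTheory.lt_neqAle; apply/andP; split.
    apply/eqP => psE; have /psm[_] : val ps (a, b).
      by rewrite psE pE; apply: p_rel_endpoints.
    by apply.
  by apply/leRegP; rewrite pE => z /psm[].
exists ps; split=> //; split.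
  split=> // x [psx /below].
  by rewrite Order.POrderTheory.lt_geF.
(* Another lower cover [q] would lie below [ps], putting [ps] strictly between [q] and [p]. *)
move=> q [qp nq]; apply/eqP; rewrite eq_sym; apply: contrapT => /negP qps.
apply: (nq ps); split=> //.
by rewrite Order.POrderTheory.lt_neqAle qps; apply: below.
Qed.

Lemma open_p_rel_sub (u : set (E * E)) a b : rel_open e u -> u (a, b) ->
  exists2 U, triples e (a, b, U) & p_rel e (a, b, U) `<=` u.
Proof.
move=> [ue uo] uab.
exists [set y | [/\ rel_interval e a b y, u (a, y) & a <> b -> y <> a]].
  split=> [|y []//|ab]; first exact: ue.
  split; first by case=> _ _ /(_ ab).
  split=> // [|_ ba]; last by apply: ab.
  by split; [left; apply: ue|right].
move=> [x y] [exy [/= xl yr]].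
have uay : u (a, y) by case: yr => [->|[]].
have [->//|xa] := pselect (x = a).
case: xl => [//|[xI nx]].
have eax : e (a, x) by case: xI => [[//|/esym//]].
(* A source [x] other than [a] has [(a, x)] outside [u]; if [(x, y)] were outside too, openness
   would exclude [(a, y)]. *)
apply: contrapT => nxy.
have nax : ~ u (a, x) by move=> uax; apply: nx.
by have [] := uo a x y (conj eax nax) (conj exy nxy).
Qed.

Lemma supremum_p_rel (x : Reg e) :
  supremums [set r : Reg e |
    (exists2 t, triples e t & val r = p_rel e t) /\ (r <= x)%O] x.
Proof.
apply/supremums_RegP => //; apply/seteqP; have [_ xE] := regP x; split.
  rewrite {1}xE; apply: rel_cl_mono => -[a b] iab.
  have [U T pu] := open_p_rel_sub (rel_int_open etr (val x)) iab.
  have preg : p_rel e (a, b, U) \in regular_closed e.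
    by rewrite inE; apply: p_rel_regular.
  exists (Sub (p_rel e (a, b, U)) preg : Reg e).
    split; first by exists (a, b, U).
    by apply/leRegP => z /pu/rel_int_sub.
  by apply: p_rel_endpoints; case: T.
apply: rel_cl_min; first by rewrite xE; apply: rel_cl_trans.
by move=> z [r [_ /leRegP rx] /rx].
Qed.

End PRel.

Theorem theorem5p8 (E : Type) (e : set (E * E)) (etr : rel_transitive e) :
  [set val p | p in [set p : Reg e | completely_join_irreducible p]]
    = [set p_rel e t | t in triples e]
  /\ spatial (Reg e).
Proof.
split; last first.
  move=> x; eexists; last exact: supremum_p_rel.
  by move=> r [[t Tt rE] _]; apply: p_rel_irreducible rE.
apply/seteqP; split.
  move=> _ [p [ps [[[psp _] _] below]] <-]; apply: contrapT => np.
  (* If [p] is not of the form [p_rel e t], all such sets below it are strictly below, hence under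
     [ps], and so is their supremum [p]. *)
  have [_ /(_ ps) lub] := supremum_p_rel etr p.
  suff : (p <= ps)%O by rewrite Order.POrderTheory.lt_geF.
  apply: lub => r [[t Tt rE] rp]; apply: below.
  rewrite Order.POrderTheory.lt_neqAle rp andbT.
  by apply/eqP => rpE; apply: np; exists t => //; rewrite -rE rpE.
move=> _ [t Tt <-].
have preg : p_rel e t \in regular_closed e by rewrite inE; apply: p_rel_regular.
by exists (Sub (p_rel e t) preg : Reg e) => //; apply: p_rel_irreducible Tt _.
Qed.
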